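(* Let $G_1$ and $G_2$ be edge-disjoint graphs, and let $f=(x,y)$ be a pair of vertices with $x,y\in V(G_1)\cap V(G_2)$ that is a nonedge of both $G_1$ and $G_2$. Then $G_1\cup G_2$ is: (i) nucleation-free, if $G_1$ and $G_2$ are nucleation-free and $V(G_1)\cap V(G_2)=\{x,y\}$; (ii) dependent, if $f$ is an implied nonedge of both $G_1$ and $G_2$; (iii) a circuit, if $V(G_1)\cap V(G_2)=\{x,y\}$ and both $G_1\cup f$ and $G_2\cup f$ are circuits. Moreover, in cases (ii) and (iii), $f$ is an implied nonedge of $G_1\cup G_2$.
   Context: All graphs are finite and simple. Rank, independence, rigidity and circuits refer to the 3-dimensional generic rigidity matroid $\mathcal{R}_3$ (a graph is identified with its edge set). $G$ is independent if $\mathrm{rank}(G)=|E(G)|$, dependent otherwise; rigid if its rank equals that of the complete graph on $V(G)$ ($=3|V(G)|-6$ when $|V(G)|\ge 3$). $G\cup f$ denotes $G$ with the pair $f$ added as an edge. A nonedge $f$ of $G$ is implied if $G\cup f$ contains a circuit containing $f$. A nucleation is a rigid subgraph on at least $5$ vertices; nucleation-free means having none. $G_1\cup G_2$ is the graph with vertex set $V(G_1)\cup V(G_2)$ and edge set $E(G_1)\cup E(G_2)$. *)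

(* Defs.v *)
From HB Require Import structures.
From mathcomp Require Import all_boot all_order all_algebra.
From mathcomp Require Import mpoly.

Set Implicit Arguments.
Unset Strict Implicit.
Unset Printing Implicit Defensive.

Import GRing.Theory.

(* The vertex set is part of the data (isolated vertices are allowed), inside an
   ambient finite type T; sharing T makes unions and intersections of graphs
   meaningful. *)
Record graph (T : finType) := Graph {
  verts : {set T};
  edges : {set {set T}};
  edgesP : forall e, e \in edges -> e \subset verts /\ #|e| = 2 }.

Section Graphs.
Variable T : finType.
Implicit Types (G H : graph T) (V : {set T}) (f : {set T}).

Definition subgraph H G := verts H \subset verts G /\ edges H \subset edges G.

Definition complete_edges V : {set {set T}} :=
  [set e : {set T} | (e \subset V) & #|e| == 2].

Lemma complete_edgesP V e : e \in complete_edges V -> e \subset V /\ #|e| = 2.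
Proof. by rewrite inE => /andP[-> /eqP ->]. Qed.

Definition complete V : graph T := Graph (@complete_edgesP V).

Lemma gunion_edgesP G1 G2 e : e \in edges G1 :|: edges G2 ->
  e \subset verts G1 :|: verts G2 /\ #|e| = 2.
Proof.
by rewrite inE => /orP[] /edgesP[sub ->]; split=> //;
  apply: subset_trans sub _; rewrite ?subsetUl ?subsetUr.
Qed.

Definition gunion G1 G2 : graph T := Graph (@gunion_edgesP G1 G2).

Definition nonedge G f : Prop :=
  [/\ f \subset verts G, #|f| = 2 & f \notin edges G].

End Graphs.

Section GenericRigidityMatroid.
Local Open Scope ring_scope.
Variable T : finType.
Implicit Types (G H : graph T) (F C : {set {set T}}) (e f : {set T}).

Definition ncoord : nat := #|{: T * 'I_3}|.

(* The field Q(X_(v,i) : v in T, i < 3). *)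
Definition coord_field : fieldType := {fraction {mpoly rat[ncoord]}}.

(* The generic placement of T in 3-space: its coordinates are the
   indeterminates, hence algebraically independent over Q.  Any placement in R^3
   with algebraically independent coordinates generates an isomorphic field, so
   it induces the same row matroid. *)
Definition gpoint (v : T) : 'rV[coord_field]_3 :=
  \row_(i < 3) tofrac 'X_(enum_rank (v, i)).

(* For e = {u, v} the sum is p_u - p_v in the three columns of u and p_v - p_u
   in those of v: the usual row of the rigidity matrix, with no need to orient e. *)
Definition rigidity_entry e (w : T) (i : 'I_3) : coord_field :=
  if w \in e then (\sum_(u in e) (gpoint w - gpoint u)) 0 i else 0.

(* The columns of vertices of T that meet no edge of F are zero, so the rank
   does not depend on the ambient type. *)
Definition rigidity_mx F : 'M[coord_field]_(#|F|, ncoord) :=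
  \matrix_(a, b) rigidity_entry (enum_val a) (enum_val b).1 (enum_val b).2.

Definition rank F : nat := \rank (rigidity_mx F).

Definition independent F : bool := rank F == #|F|.

Definition dependent F : bool := ~~ independent F.

Definition circuit C : bool := minset dependent C.

Definition rigid G : Prop := rank (edges G) = rank (edges (complete (verts G))).

Definition nucleation G H : Prop :=
  [/\ subgraph H G, rigid H & (5 <= #|verts H|)%N].

Definition nucleation_free G : Prop := ~ exists H, nucleation G H.

Definition implied_nonedge G f : Prop :=
  nonedge G f /\ exists C, [/\ C \subset f |: edges G, f \in C & circuit C].

End GenericRigidityMatroid.

(* Main.v *)
(* A dependency among rigidity rows is a self-stress, and the rows are orthogonal
   to the infinitesimal motions of space.
   (ii) Normalise the stresses of the two circuits to be 1 on f; their difference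
   vanishes on f and is supported on the union, and it is nonzero because a single
   row is nonzero.
   (iii) Split a stress of (E1 - e) u E2 into its two parts.  They exert opposite
   loads, so the load lives on V1 n V2 = {x, y}; being in equilibrium it is a
   multiple of the row of f.  Independence of (E1 - e) u f makes that multiple and
   the first part vanish, and independence of E2 kills the second.
   (i) If a subgraph H has a vertex a outside V2 and a vertex b outside V1, rotate
   V1 about the line xy and fix V2.  This preserves the edges of H but not the
   pair ab, since four generic points are affinely independent; so H is not rigid. *)

Require Import Defs.
From mathcomp Require Import all_boot all_order all_algebra.
From mathcomp Require Import mpoly ring.

Set Implicit Arguments.
Unset Strict Implicit.
Unset Printing Implicit Defensive.

Import GRing.Theory.

(** * Cross products in 3-space *)

Section Vectors.
Local Open Scope ring_scope.
Variable K : fieldType.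
Implicit Types u v w : 'I_3 -> K.

Definition i0 : 'I_3 := @Ordinal 3 0 isT.
Definition i1 : 'I_3 := @Ordinal 3 1 isT.
Definition i2 : 'I_3 := @Ordinal 3 2 isT.

Lemma I3P (P : 'I_3 -> Prop) : P i0 -> P i1 -> P i2 -> forall i, P i.
Proof.
move=> P0 P1 P2 [[|[|[|//]]] lti].
- by rewrite (_ : Ordinal lti = i0) //; apply: val_inj.
- by rewrite (_ : Ordinal lti = i1) //; apply: val_inj.
- by rewrite (_ : Ordinal lti = i2) //; apply: val_inj.
Qed.

Lemma sum_I3 (f : 'I_3 -> K) : \sum_i f i = f i0 + f i1 + f i2.
Proof.
rewrite !big_ord_recl big_ord0 addr0 addrA.
by congr (f _ + f _ + f _); apply: val_inj.
Qed.

Definition cross u v (i : 'I_3) : K :=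
  match val i with
  | 0 => u i1 * v i2 - u i2 * v i1
  | 1 => u i2 * v i0 - u i0 * v i2
  | _ => u i0 * v i1 - u i1 * v i0
  end.

Lemma crossvv u i : cross u u i = 0.
Proof. by move: i; apply: I3P; rewrite /cross /=; ring. Qed.

Lemma cross0v v i : cross (fun _ => 0) v i = 0.
Proof. by move: i; apply: I3P; rewrite /cross /=; ring. Qed.

Lemma eq_cross u u' v v' : u =1 u' -> v =1 v' -> cross u v =1 cross u' v'.
Proof. by move=> eu ev i; rewrite /cross !eu !ev. Qed.

(** Since a . (r x d) = d . (a x r), the hypothesis says a x r = 0. Two basis vectors [d] give the
    proportions of [a i1] and [a i2] to [a i0]. *)
Lemma parallel_of_cross_eq0 (a r : 'I_3 -> K) : r i0 != 0 ->
  (forall d, \sum_i a i * cross r d i = 0) -> forall i, a i = a i0 / r i0 * r i.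
Proof.
move=> r0 ax i.
have E1 : a i1 * r i0 = a i0 * r i1.
  have := ax (fun j => (j == i2)%:R); rewrite sum_I3 /cross /= => E.
  by apply/eqP; rewrite -subr_eq0 -oppr_eq0 -{}E; apply/eqP; ring.
have E2 : a i2 * r i0 = a i0 * r i2.
  have := ax (fun j => (j == i1)%:R); rewrite sum_I3 /cross /= => E.
  by apply/eqP; rewrite -subr_eq0 -{}E; apply/eqP; ring.
rewrite mulrAC; apply: (mulIf r0); rewrite mulfVK //.
by move: i; apply: I3P.
Qed.

End Vectors.

(** * Rigidity rows paired with infinitesimal motions *)

Section RigidityMatroid.
Local Open Scope ring_scope.
Variable T : finType.
Notation K := (coord_field T).
Implicit Types (u v w : T) (e f : {set T}) (F : {set {set T}}).
Implicit Types m : T -> 'I_3 -> K.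

Definition pos w (i : 'I_3) : K := gpoint w 0 i.

Lemma rigidity_entry_pair u v w i : u != v ->
  rigidity_entry [set u; v] w i =
  (w == u)%:R * (pos u i - pos v i) + (w == v)%:R * (pos v i - pos u i).
Proof.
move=> uv; rewrite /rigidity_entry !inE big_setU1 ?inE // big_set1.
case: (eqVneq w u) => [-> | wu] /=.
  by rewrite (negbTE uv) mul1r mul0r addr0 subrr add0r /pos !mxE.
case: (eqVneq w v) => [-> | wv] /=.
  by rewrite mul1r mul0r add0r subrr addr0 /pos !mxE.
by rewrite !mul0r addr0.
Qed.

Lemma rigidity_entry_out e w i : w \notin e -> rigidity_entry e w i = 0.
Proof. by rewrite /rigidity_entry => /negbTE->. Qed.

(** For a pair [e], half the rate of change of its squared length when the vertices move with
    velocities [m]. *)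
Definition power e m : K := \sum_w \sum_i rigidity_entry e w i * m w i.

Lemma power_pair u v m : u != v ->
  power [set u; v] m = \sum_i (pos u i - pos v i) * (m u i - m v i).
Proof.
move=> uv; rewrite /power exchange_big; apply: eq_bigr => i _.
transitivity (\sum_(w in [set u; v]) rigidity_entry [set u; v] w i * m w i).
  rewrite [RHS]big_mkcond; apply: eq_bigr => w _.
  by case: ifPn => // nw; rewrite rigidity_entry_out ?mul0r.
rewrite big_setU1 ?inE // big_set1 !rigidity_entry_pair //.
by rewrite !eqxx (negbTE uv) eq_sym (negbTE uv) /=; ring.
Qed.

Lemma power_translation e c : #|e| = 2 -> power e (fun _ => c) = 0.
Proof.
move=> /eqP/cards2P[u [v [uv ->]]]; rewrite power_pair // big1 // => i _.
by rewrite subrr mulr0.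
Qed.

(** The velocities are those of a rotation about the axis through [q] in direction [d]. At the ends
    of an edge they differ by (p_u - p_v) x d, which is orthogonal to p_u - p_v. *)
Lemma power_rotation e (q d : 'I_3 -> K) : #|e| = 2 ->
  power e (fun w => cross (fun i => pos w i - q i) d) = 0.
Proof.
move=> /eqP/cards2P[u [v [uv ->]]]; rewrite power_pair // sum_I3 /cross /=.
by ring.
Qed.


(** * Self-stresses, dependence and circuits *)

(** Coefficients live on all subsets of [T], with the support imposed separately, so that stresses
    of different edge sets can be added. *)
Definition stress (a : {set T} -> K) : Prop :=
  forall w i, \sum_e a e * rigidity_entry e w i = 0.

Lemma mul_rigidity_mx F (a : {set T} -> K) w i :
  (forall e, e \notin F -> a e = 0) ->
  (\row_k a (enum_val k) *m rigidity_mx F) 0 (enum_rank (w, i)) =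
  \sum_e a e * rigidity_entry e w i.
Proof.
move=> supp; rewrite mxE; transitivity (\sum_(e in F) a e * rigidity_entry e w i).
  rewrite [RHS]big_enum_val; apply: eq_bigr => k _.
  by rewrite !mxE enum_rankK.
rewrite big_mkcond; apply: eq_bigr => e _.
by case: ifPn => // /supp->; rewrite mul0r.
Qed.

Lemma dependentP F :
  reflect (exists a, [/\ forall e, e \notin F -> a e = 0, stress a
                       & exists e, a e != 0])
          (dependent F).
Proof.
rewrite /dependent /independent -[_ == _]/(row_free _).
apply: (iffP idP) => [|[a [supp az [e]]]].
  rewrite -kermx_eq0 => /rowV0Pn[r /sub_kermxP rz r0].
  (* The kernel vector [r], extended by 0 outside [F]. *)
  pose a e := if [pick k | enum_val k == e] is Some k then r 0 k else 0.
  have rE : r = \row_k a (enum_val k).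
    apply/rowP=> k; rewrite mxE /a.
    by case: pickP => [k' /eqP/enum_val_inj-> //|/(_ k)]; rewrite eqxx.
  have supp e : e \notin F -> a e = 0.
    by rewrite /a; case: pickP => // k /eqP<- /negP[]; apply: enum_valP.
  exists a; split=> // [w i|].
    by rewrite -(mul_rigidity_mx w i supp) -rE rz mxE.
  by case/rV0Pn: r0 => k; rewrite rE mxE => ak; exists (enum_val k).
apply: contra_neqN => free; have [eF | /supp//] := boolP (e \in F).
have/eqP : \row_k a (enum_val k) *m rigidity_mx F = 0.
  apply/rowP=> j; rewrite -(enum_valK j); case: (enum_val j) => w i.
  by rewrite mul_rigidity_mx // az mxE.
rewrite mulmx_free_eq0 // => /eqP/rowP/(_ (enum_rank_in eF e)).
by rewrite !mxE enum_rankK_in.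
Qed.

Lemma independentP F :
  reflect (forall a, (forall e, e \notin F -> a e = 0) -> stress a ->
             forall e, a e = 0)
          (independent F).
Proof.
apply: (iffP idP) => [ind a supp az e | free].
  apply: contraTeq ind => ae; apply/dependentP.
  by exists a; split=> //; exists e.
apply: contraT => /dependentP[a [supp az [e]]].
by rewrite (free a) ?eqxx.
Qed.

Lemma sub_independent F F' : F \subset F' -> independent F' -> independent F.
Proof.
move=> sub /independentP free; apply/independentP => a supp; apply: free => e eF'.
by apply: supp; apply: contra eF'; apply: (subsetP sub).
Qed.

Lemma circuit_dependent F : circuit F -> dependent F.
Proof. by case/minsetP. Qed.

Lemma circuit_proper_independent F F' :
  circuit F -> F' \proper F -> independent F'.
Proof.
case/minsetP=> _ minF; rewrite properEneq => /andP[ne sub].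
by apply: contraNT ne => dep; rewrite (minF F').
Qed.

(** A nonzero stress of a circuit cannot vanish at one of its edges [e]: it would be a stress of the
    independent set [F :\ e]. Hence it can be scaled to 1 at [e]. *)
Lemma circuit_stress F e : circuit F -> e \in F ->
  exists a, [/\ forall e, e \notin F -> a e = 0, stress a & a e = 1].
Proof.
move=> circF eF; have /dependentP[a [supp az [e' ae']]] := circuit_dependent circF.
have ae : a e != 0.
  apply: contraNneq ae' => ae.
  have /independentP-> // := circuit_proper_independent circF (properD1 eF).
  move=> e1; rewrite !inE negb_and negbK => /orP[/eqP->//|]; exact: supp.
exists (fun e1 => a e1 / a e); split; last exact: divff.
  by move=> e1 /supp->; rewrite mul0r.
move=> w i; under eq_bigr do rewrite mulrAC.
by rewrite -mulr_suml az mul0r.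
Qed.

(** * Generic points, and loads on two vertices *)

(** A polynomial with a nonzero value at one rational placement [q] is not the zero polynomial, so
    it does not vanish at the generic placement. *)
Lemma pos_generic (P : {mpoly rat[ncoord T]}) (q : T -> 'I_3 -> rat) :
  P.@[fun k => q (enum_val k).1 (enum_val k).2] != 0 -> tofrac P != 0 :> K.
Proof. by rewrite tofrac_eq0; apply: contra_neq => ->; rewrite meval0. Qed.

Lemma posE w i : pos w i = tofrac 'X_(enum_rank (w, i)).
Proof. by rewrite /pos mxE. Qed.

Lemma pos_neq u v : u != v -> pos u i0 - pos v i0 != 0.
Proof.
move=> uv; rewrite !posE -tofracB.
(* Test placement: [u] at (1,1,1), all other vertices at the origin. *)
apply: (pos_generic (q := fun w _ => (w == u)%:R)).
by rewrite mevalB !mevalXU !enum_rankK /= eqxx [v == u]eq_sym (negbTE uv).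
Qed.

(** The sum is a triple product: up to sign, six times the volume of the tetrahedron on [x], [y],
    [a], [b]. *)
Lemma pos_affinely_independent x y a b :
  uniq [:: x; y; a; b] ->
  \sum_i (pos a i - pos b i) *
     cross (fun j => pos a j - pos x j) (fun j => pos y j - pos x j) i != 0.
Proof.
rewrite /= !inE !negb_or => /and4P[/and3P[xy xa xb] /andP[ya yb] ab _].
rewrite sum_I3 /cross /= !posE -!(tofracB, tofracM, tofracD).
(* Test placement: [x] at the origin and [y], [a], [b] at the three basis vectors. *)
apply: (pos_generic (q := fun w i =>
  ((w == y) && (i == i0) || (w == a) && (i == i1) || (w == b) && (i == i2))%:R)).
rewrite !(mevalB, mevalM, mevalD, mevalXU) !enum_rankK /= !eqxx.
rewrite (negbTE xy) (negbTE xa) (negbTE xb) (negbTE ya) (negbTE yb) (negbTE ab).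
rewrite ![a == y]eq_sym ![b == y]eq_sym ![b == a]eq_sym.
by rewrite (negbTE ya) (negbTE yb) (negbTE ab).
Qed.

(* Translations force [L y = - L x]; rotations then force [L x] to be parallel
   to [pos x - pos y]. *)
Lemma load_pair x y (L : T -> 'I_3 -> K) : x != y ->
  (forall w i, w \notin [set x; y] -> L w i = 0) ->
  (forall c, \sum_w \sum_i L w i * c i = 0) ->
  (forall d, \sum_w \sum_i L w i * cross (pos w) d i = 0) ->
  exists c, forall w i, L w i = c * rigidity_entry [set x; y] w i.
Proof.
move=> xy supp tr rot.
have sum2 (m : T -> 'I_3 -> K) : \sum_w \sum_i L w i * m w i =
    \sum_i L x i * m x i + \sum_i L y i * m y i.
  transitivity (\sum_(w in [set x; y]) \sum_i L w i * m w i); last first.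
    by rewrite big_setU1 ?inE // big_set1.
  rewrite [RHS]big_mkcond; apply: eq_bigr => w _; case: ifPn => // wxy.
  by rewrite big1 // => i _; rewrite supp ?mul0r.
have Ly i : L y i = - L x i.
  have := tr (fun j => (j == i)%:R); rewrite (sum2 (fun _ j => (j == i)%:R)).
  have pick_i z : \sum_j L z j * (j == i)%:R = L z i.
    rewrite (bigD1 i) //= eqxx mulr1 big1 ?addr0 // => j /negbTE->.
    by rewrite mulr0.
  by rewrite !pick_i => /eqP; rewrite addrC addr_eq0 => /eqP.
have xd d : \sum_i L x i * cross (fun j => pos x j - pos y j) d i = 0.
  rewrite -[RHS](rot d) (sum2 (fun w => cross (pos w) d)) !sum_I3 !Ly /cross /=.
  by ring.
exists (L x i0 / (pos x i0 - pos y i0)) => w i.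
rewrite rigidity_entry_pair //.
have [wxy | wxy] := boolP (w \in [set x; y]); last first.
  rewrite supp //; move: wxy; rewrite !inE negb_or => /andP[/negbTE-> /negbTE->].
  by rewrite !mul0r addr0 mulr0.
have Lx := parallel_of_cross_eq0 (pos_neq xy) xd i.
move: wxy; rewrite !inE => /orP[/eqP-> | /eqP->].
  by rewrite eqxx (negbTE xy) Lx mul1r mul0r addr0.
by rewrite Ly eqxx eq_sym (negbTE xy) Lx mul1r mul0r add0r -mulrN opprB.
Qed.

(** * Independence of 2-sums *)

(** Exchanging the sums turns the work of the load along [m] into a combination of the powers of the
    edges. For translations and rotations this says that the load is in equilibrium. *)
Lemma power_load F (a : {set T} -> K) m :
  (forall e, e \in F -> power e m = 0) -> (forall e, e \notin F -> a e = 0) ->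
  \sum_w \sum_i (\sum_e a e * rigidity_entry e w i) * m w i = 0.
Proof.
move=> Fm supp.
transitivity (\sum_e a e * power e m); last first.
  rewrite big1 // => e _; case: (boolP (e \in F)) => [/Fm->|/supp->].
    by rewrite mulr0.
  by rewrite mul0r.
transitivity (\sum_w \sum_e \sum_i a e * rigidity_entry e w i * m w i).
  apply: eq_bigr => w _; rewrite exchange_big; apply: eq_bigr => i _.
  by rewrite mulr_suml.
rewrite exchange_big; apply: eq_bigr => e _; rewrite /power mulr_sumr.
by apply: eq_bigr => w _; rewrite mulr_sumr; apply: eq_bigr => i _; rewrite mulrA.
Qed.

(** The two sides play different roles: [F1] is to be the side that lost an edge, so it stays
    independent with the pair [xy] adjoined, while [F2] is the intact side. *)
Lemma independent_2sum (V1 V2 : {set T}) F1 F2 x y :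
  x != y -> V1 :&: V2 \subset [set x; y] ->
  F1 \subset complete_edges V1 -> F2 \subset complete_edges V2 ->
  [disjoint F1 & F2] -> [set x; y] \notin F1 ->
  independent ([set x; y] |: F1) -> independent F2 -> independent (F1 :|: F2).
Proof.
move=> xy V12 F1V1 F2V2 dis nf /independentP free1 /independentP free2.
have out F V e w i : F \subset complete_edges V -> e \in F -> w \notin V ->
    rigidity_entry e w i = 0.
  move=> /subsetP FV /FV/complete_edgesP[/subsetP eV _] wV.
  by apply: rigidity_entry_out; apply: contra wV; apply: eV.
apply/independentP => a supp az.
pose a1 e := if e \in F1 then a e else 0.
pose a2 e := if e \in F2 then a e else 0.
have aE e : a e = a1 e + a2 e.
  rewrite /a1 /a2; case: ifPn => [eF1|nF1].
    by rewrite (disjointFr dis eF1) addr0.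
  rewrite add0r; case: ifPn => // nF2; apply: supp.
  by rewrite inE negb_or nF1.
pose L w i := \sum_e a1 e * rigidity_entry e w i.
have LE w i : L w i = - \sum_e a2 e * rigidity_entry e w i.
  apply/eqP; rewrite -addr_eq0 -big_split -[X in _ == X](az w i) /=.
  by apply/eqP; apply: eq_bigr => e _; rewrite aE mulrDl.
have supp1 e : e \notin F1 -> a1 e = 0 by rewrite /a1 => /negbTE->.
have supp2 e : e \notin F2 -> a2 e = 0 by rewrite /a2 => /negbTE->.
have sizeF1 e : e \in F1 -> #|e| = 2 by move/(subsetP F1V1)/complete_edgesP=> [].
have [c Lc] : exists c, forall w i, L w i = c * rigidity_entry [set x; y] w i.
  apply: load_pair => // [w i wxy|c|d].
  (* A vertex other than [x] and [y] misses [V1] or [V2]; the load there is computed from the part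
     of the stress on the missed side. *)
  - have [wV1|wV1] := boolP (w \in V1); last first.
      rewrite /L big1 // => e _; have [eF|/supp1->] := boolP (e \in F1).
        by rewrite (out _ _ _ _ _ F1V1 eF wV1) mulr0.
      by rewrite mul0r.
    have wV2 : w \notin V2.
      apply: contra wxy => wV2; apply: (subsetP V12); exact/setIP.
    rewrite LE big1 ?oppr0 // => e _; have [eF|/supp2->] := boolP (e \in F2).
      by rewrite (out _ _ _ _ _ F2V2 eF wV2) mulr0.
    by rewrite mul0r.
  - by apply: (power_load _ supp1) => e /sizeF1; apply: power_translation.
  - apply: (power_load _ supp1) => e /sizeF1 /(power_rotation (fun _ => 0) d) <-.
    apply: eq_bigr => w _; apply: eq_bigr => i _; congr (_ * _).
    by apply: eq_cross => // j; rewrite subr0.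
(* Coefficient [- c] on the pair [xy] cancels the load of [a1], which gives a stress on [[set x; y]
   |: F1]. *)
have b0 := free1 (fun e => a1 e - (e == [set x; y])%:R * c).
have {}b0 : forall e, a1 e - (e == [set x; y])%:R * c = 0.
  apply: b0 => [e|w i]; first rewrite !inE negb_or => /andP[/negbTE-> /supp1->].
    by rewrite mul0r subrr.
  under eq_bigr do rewrite mulrBl.
  rewrite sumrB -/(L w i) Lc (bigD1 [set x; y]) //= eqxx mul1r big1 ?addr0 ?subrr //.
  by move=> e /negbTE->; rewrite !mul0r.
have c0 : c = 0.
  by have /eqP := b0 [set x; y]; rewrite supp1 // eqxx mul1r sub0r oppr_eq0 => /eqP.
have a10 e : a1 e = 0 by rewrite -[RHS](b0 e) c0 mulr0 subr0.
move=> e; rewrite aE a10 add0r; apply: free2 => // w i.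
by apply/eqP; rewrite -oppr_eq0 -LE Lc c0 mul0r.
Qed.

(** * Rigidity tested by infinitesimal motions *)

Lemma rigidity_mx_mul_motion F m k :
  (rigidity_mx F *m \col_j m (enum_val j).1 (enum_val j).2) k 0 =
  power (enum_val k) m.
Proof.
rewrite mxE /power pair_big [RHS](reindex (@enum_val _ predT)) /=.
  by apply: eq_bigr => j _; rewrite !mxE.
exact/onW_bij/enum_val_bij.
Qed.

(** Equal ranks and inclusion make the row spaces of [G] and of the complete graph coincide, so a
    motion orthogonal to the rows of [G] is orthogonal to all rows. *)
Lemma rigid_power G m : rigid G ->
  (forall e, e \in edges G -> power e m = 0) ->
  forall e, e \in complete_edges (verts G) -> power e m = 0.
Proof.
move=> rigG Gm e eV.
pose M : 'cV[K]_(ncoord T) := \col_j m (enum_val j).1 (enum_val j).2.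
have GM : rigidity_mx (edges G) *m M = 0.
  apply/matrixP=> k j; rewrite ord1 rigidity_mx_mul_motion mxE.
  exact/Gm/enum_valP.
have sub : (rigidity_mx (edges G) <= rigidity_mx (complete_edges (verts G)))%MS.
  apply/row_subP=> k.
  have kV : enum_val k \in complete_edges (verts G).
    by have [s c] := edgesP (enum_valP k); rewrite inE s c eqxx.
  rewrite (_ : row k _ = row (enum_rank_in kV (enum_val k))
                (rigidity_mx (complete_edges (verts G)))) ?row_sub //.
  by apply/rowP=> j; rewrite !mxE enum_rankK_in.
have /mxrank_leqif_eq[_] := sub; rewrite [X in X == _]rigG eqxx => /esym/andP[_].
case/submxP=> D DE.
rewrite -(enum_rankK_in eV eV) -rigidity_mx_mul_motion -/M DE -mulmxA GM mulmx0.
by rewrite mxE.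
Qed.

(** Meant for a candidate nucleation [G] that lies in neither side of the union. *)
Lemma separated_not_rigid (V1 V2 : {set T}) G x y a b :
  x != y -> V1 :&: V2 = [set x; y] ->
  verts G \subset V1 :|: V2 ->
  edges G \subset complete_edges V1 :|: complete_edges V2 ->
  a \in verts G :\: V2 -> b \in verts G :\: V1 -> ~ rigid G.
Proof.
move=> xy V12 /subsetP vG GV /setDP[aG aV2] /setDP[bG bV1] rigG.
have xyV : (x \in V1) && (x \in V2) && (y \in V1) && (y \in V2).
  by rewrite -!in_setI -andbA -in_setI V12 !inE !eqxx orbT.
have [/andP[/andP[xV1 xV2] yV1] yV2] := (andP xyV).
have neq u v (V : {set T}) : u \in V -> v \notin V -> u != v.
  by move=> uV; apply: contraNneq => <-.
pose q i := pos y i - pos x i.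
pose m w i := if w \in V2 then 0 else cross (fun j => pos w j - pos x j) q i.
(* The two definitions of [m] agree on the overlap because [x] and [y] lie on the rotation axis. *)
have mV1 w i : w \in V1 -> m w i = cross (fun j => pos w j - pos x j) q i.
  rewrite /m => wV1; case: ifP => // wV2.
  have : w \in V1 :&: V2 by apply/setIP.
  rewrite V12 !inE => /orP[/eqP->|/eqP->]; last by rewrite crossvv.
  by rewrite -[LHS](cross0v q i); apply: eq_cross => // j; rewrite subrr.
have Gm e : e \in edges G -> power e m = 0.
  move=> /(subsetP GV); rewrite inE => /orP[]/complete_edgesP[/subsetP eV e2].
    rewrite -[RHS](power_rotation (pos x) q e2).
    apply: eq_bigr => w _; apply: eq_bigr => i _.
    have [/eV/mV1->//|/rigidity_entry_out->] := boolP (w \in e).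
    by rewrite !mul0r.
  rewrite /power big1 // => w _; rewrite big1 // => i _.
  have [/eV wV2|/rigidity_entry_out->] := boolP (w \in e); last by rewrite mul0r.
  by rewrite /m wV2 mulr0.
have aV1 : a \in V1 by move/vG: aG; rewrite inE (negbTE aV2) orbF.
have bV2 : b \in V2 by move/vG: bG; rewrite inE (negbTE bV1).
have ab : a != b := neq _ _ _ aV1 bV1.
have abG : [set a; b] \in complete_edges (verts G).
  by rewrite inE cards2 ab subUset !sub1set aG bG.
have /eqP := rigid_power rigG Gm abG; rewrite power_pair //.
(* As [b] is at rest, the power of the pair [ab] is the triple product of the four generic
   points. *)
apply/negP; under eq_bigr do rewrite mV1 // /m bV2 subr0.
apply: pos_affinely_independent; rewrite /= !inE !negb_or xy ab.
by rewrite (neq x a V2) ?(neq x b V1) ?(neq y a V2) ?(neq y b V1).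
Qed.

End RigidityMatroid.

(** * Unions of two graphs *)

Lemma edges_sub_complete (T : finType) (G : graph T) :
  edges G \subset complete_edges (verts G).
Proof. by apply/subsetP=> e /edgesP[sub c]; rewrite inE sub c eqxx. Qed.

Lemma edges_gunionC (T : finType) (G1 G2 : graph T) :
  edges (gunion G1 G2) = edges (gunion G2 G1).
Proof. exact: setUC. Qed.

Section GraphUnion.
Variable T : finType.
Implicit Types (G : graph T) (f : {set T}) (x y : T).

Lemma gunion_nonedge G1 G2 f :
  nonedge G1 f -> nonedge G2 f -> nonedge (gunion G1 G2) f.
Proof.
move=> [s1 c n1] [_ _ n2]; split=> //=; last by rewrite inE negb_or n1.
exact: subset_trans (subsetUl _ _).
Qed.

Lemma gunion_implied_nonedge G1 G2 f :
  implied_nonedge G1 f -> nonedge G2 f -> implied_nonedge (gunion G1 G2) f.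
Proof.
move=> [n1 [C [sC fC circC]]] n2; split; first exact: gunion_nonedge.
by exists C; split=> //; apply: subset_trans sC (setUS _ (subsetUl _ _)).
Qed.

Lemma gunion_dependent G1 G2 f : [disjoint edges G1 & edges G2] ->
  implied_nonedge G1 f -> implied_nonedge G2 f -> dependent (edges (gunion G1 G2)).
Proof.
move=> dis [[_ c2 n1] [C1 [sC1 fC1 circ1]]] [[_ _ n2] [C2 [sC2 fC2 circ2]]].
have [a1 [supp1 az1 a1f]] := circuit_stress circ1 fC1.
have [a2 [supp2 az2 a2f]] := circuit_stress circ2 fC2.
have notin e G (C : {set {set T}}) (a : {set T} -> coord_field T) : C \subset f |: edges G ->
    (forall e, e \notin C -> a e = 0%R) -> e != f -> e \notin edges G -> a e = 0%R.
  move=> sC supp ef neG; apply: supp; apply: contra neG => /(subsetP sC).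
  by rewrite !inE (negbTE ef).
apply/dependentP; exists (fun e => (a1 e - a2 e)%R); split.
- move=> e; rewrite inE negb_or => /andP[e1 e2].
  have [->|ef] := eqVneq e f; first by rewrite a1f a2f subrr.
  by rewrite (notin e G1 C1 a1) // (notin e G2 C2 a2) // subrr.
- move=> w i; under eq_bigr do rewrite mulrBl.
  by rewrite sumrB az1 az2 subrr.
(* If [a1] vanished off [f], its balance at the end [u] of [f] would make the first coordinates of
   [u] and [v] equal. *)
have [e e1 ae] : exists2 e, e != f & a1 e != 0%R.
  apply/exists_inP; apply: contraT; rewrite negb_exists_in => /forall_inP a10.
  case/eqP/cards2P: c2 => u [v [uv fE]].
  have := az1 u i0; rewrite (bigD1 f) //= big1 ?addr0 => [|e /a10/negPn/eqP->].
    rewrite a1f mul1r fE rigidity_entry_pair // eqxx (negbTE uv) mul1r mul0r addr0.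
    by move/eqP; rewrite (negbTE (pos_neq uv)).
  by rewrite mul0r.
exists e; rewrite (notin e G2 C2 a2) ?subr0 //.
have : e \in edges G1 by apply: contraNT ae => /(notin _ _ _ _ sC1 supp1 e1)->.
by move/(disjointFr dis)->.
Qed.

Lemma circuit_implied_nonedge G f :
  nonedge G f -> circuit (f |: edges G) -> implied_nonedge G f.
Proof. by move=> nf circ; split=> //; exists (f |: edges G); rewrite setU11. Qed.

(** Both sides are proper subsets of circuits: the first circuit has lost [e] but keeps the pair
    [xy], the second has lost [xy]. *)
Lemma two_sum_minus_edge_independent x y G1 G2 e : x != y ->
  verts G1 :&: verts G2 = [set x; y] -> [disjoint edges G1 & edges G2] ->
  [set x; y] \notin edges G1 -> [set x; y] \notin edges G2 ->
  circuit ([set x; y] |: edges G1) -> circuit ([set x; y] |: edges G2) ->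
  e \in edges G1 -> independent (edges (gunion G1 G2) :\ e).
Proof.
move=> xy V12 dis n1 n2 circ1 circ2 e1.
have e2 : e \notin edges G2 by rewrite (disjointFr dis e1).
have ef : e != [set x; y] by apply: contraNneq n1 => <-.
have E2 : edges G2 :\ e = edges G2.
  by apply/setDidPl; rewrite disjoint_sym disjoints1.
rewrite setDUl E2.
have sub := subD1set (edges G1) e.
have V12s : verts G1 :&: verts G2 \subset [set x; y] by rewrite V12.
apply: (independent_2sum xy V12s).
- exact: subset_trans sub (edges_sub_complete G1).
- exact: edges_sub_complete.
- exact: disjointWl sub dis.
- by rewrite !inE negb_and n1 orbT.
- apply: circuit_proper_independent circ1 _.
  apply/properP; split; first exact: setUS.
  by exists e; rewrite !inE ?e1 ?orbT // (negbTE ef) eqxx.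
- apply: circuit_proper_independent circ2 _.
  by apply/properP; split; [apply: subsetUr | exists [set x; y]; rewrite // setU11].
Qed.

Lemma two_sum_circuit x y G1 G2 : x != y ->
  verts G1 :&: verts G2 = [set x; y] -> [disjoint edges G1 & edges G2] ->
  nonedge G1 [set x; y] -> nonedge G2 [set x; y] ->
  circuit ([set x; y] |: edges G1) -> circuit ([set x; y] |: edges G2) ->
  circuit (edges (gunion G1 G2)).
Proof.
move=> xy V12 dis nf1 nf2 circ1 circ2; apply/minsetP; split.
  have imp1 := circuit_implied_nonedge nf1 circ1.
  exact: gunion_dependent dis imp1 (circuit_implied_nonedge nf2 circ2).
case: nf1 nf2 => _ _ n1 [_ _ n2] F depF sub; apply/eqP.
(* A subset [F] missing some edge [e] lies in the union minus [e], which is independent. *)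
rewrite eqEsubset sub /=; apply/subsetP=> e eG; apply: contraTT depF => neF.
rewrite /dependent negbK.
have {}sub : F \subset edges (gunion G1 G2) :\ e by rewrite subsetD1 sub.
apply: sub_independent sub _; move: eG; rewrite inE => /orP[e1 | e2].
  exact: (two_sum_minus_edge_independent xy V12).
rewrite edges_gunionC; apply: (two_sum_minus_edge_independent xy) => //.
  by rewrite setIC.
by rewrite disjoint_sym.
Qed.

Lemma gunion_nucleation_free x y G1 G2 : x != y ->
  verts G1 :&: verts G2 = [set x; y] ->
  [set x; y] \notin edges G1 -> [set x; y] \notin edges G2 ->
  nucleation_free G1 -> nucleation_free G2 -> nucleation_free (gunion G1 G2).
Proof.
move=> xy V12 n1 n2 nf1 nf2 [H [[vH eH] rigH H5]].
(* If the vertices of [H] lie in [G], an edge of [H] from [G'] has both ends in the overlap, so it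
   is the nonedge [xy] of [G']. Hence [H] is a subgraph of [G]. *)
have inside G G' : verts G :&: verts G' = [set x; y] -> [set x; y] \notin edges G' ->
    edges H \subset edges G :|: edges G' -> verts H \subset verts G ->
    nucleation_free G -> False.
  move=> V n' sub vHG; apply; exists H; split=> //; split=> //.
  apply/subsetP=> e eH1; move/(subsetP sub): (eH1); rewrite inE => /orP[//|e'].
  have [eV c2] := edgesP eH1; have [eV' _] := edgesP e'.
  case/negP: n'; rewrite (_ : [set x; y] = e) //.
  apply/esym/eqP; rewrite eqEcard c2 cards2 xy -V subsetI eV' andbT.
  by rewrite (subset_trans eV).
have [s1|/subsetPn[b bH b1]] := boolP (verts H \subset verts G1).
  exact: inside V12 n2 eH s1 nf1.
have [s2|/subsetPn[a aH a2]] := boolP (verts H \subset verts G2).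
  by apply: (inside G2 G1) s2 nf2 => //; [rewrite setIC | rewrite setUC].
apply: (separated_not_rigid xy V12 (a := a) (b := b)) rigH => //.
- by apply: subset_trans eH (setUSS _ _); apply: edges_sub_complete.
- exact/setDP.
- exact/setDP.
Qed.

End GraphUnion.

Theorem theorem8 (T : finType) (G1 G2 : graph T) (x y : T)
  (Hdisj : [disjoint edges G1 & edges G2])
  (Hxy : x != y)
  (Hx : x \in verts G1 :&: verts G2)
  (Hy : y \in verts G1 :&: verts G2)
  (Hf1 : nonedge G1 [set x; y])
  (Hf2 : nonedge G2 [set x; y]) :
  [/\ (nucleation_free G1 -> nucleation_free G2 ->
       verts G1 :&: verts G2 = [set x; y] ->
       nucleation_free (gunion G1 G2)),
      (implied_nonedge G1 [set x; y] -> implied_nonedge G2 [set x; y] ->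
       dependent (edges (gunion G1 G2)) /\
       implied_nonedge (gunion G1 G2) [set x; y])
    & (verts G1 :&: verts G2 = [set x; y] ->
       circuit ([set x; y] |: edges G1) -> circuit ([set x; y] |: edges G2) ->
       circuit (edges (gunion G1 G2)) /\
       implied_nonedge (gunion G1 G2) [set x; y])].
Proof.
have [_ _ n1] := Hf1; have [_ _ n2] := Hf2; split.
- by move=> nf1 nf2 V12; apply: (gunion_nucleation_free Hxy V12).
- move=> imp1 imp2; split; first exact: gunion_dependent Hdisj imp1 imp2.
  exact: gunion_implied_nonedge.
- move=> V12 circ1 circ2; split; first exact: (two_sum_circuit Hxy V12).
  by apply: gunion_implied_nonedge Hf2; apply: circuit_implied_nonedge.
Qed.
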